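(* Let $(\mathcal{P},\mathcal{L})$ be a configuration of order $1$ of type $(n_s,m_t)$. Then its simple stacked configuration $(\mathcal{P}',\mathcal{E})$ is a configuration of order $2$ (possibly without dual), and it is of type $(2n_{s},m_{2t})$; that is, it has $2n$ points, each incident with exactly $s$ planes, and $m$ planes, each incident with exactly $2t$ points.
   Context: A configuration of order $1$ is a pair $(\mathcal{P},\mathcal{L})$, where $\mathcal{P}$ is a finite nonempty set of points and $\mathcal{L}$ is a set of (distinct) subsets of $\mathcal{P}$ called lines, such that any two distinct points are contained together in at most one line, every point is in exactly $s$ lines, every line contains exactly $t$ points, and $s,t\ge 2$. It is of type $(n_s,m_t)$ if it has $n$ points and $m$ lines with these $s$ and $t$. A configuration of order $2$ (possibly without dual) is a pair $(\mathcal{P},\mathcal{E})$, where $\mathcal{P}$ is a finite set of points and $\mathcal{E}$ is a set of (distinct) subsets of $\mathcal{P}$ called planes, such that any three distinct points are contained together in at most one plane, every point is in the same number $s$ of planes, every plane contains the same number $t$ of points, $t\ge 3$, and some pair of distinct points is contained in more than one plane. (If the requirement $s\ge 3$ fails, the configuration is said to be ''without dual''; this is allowed here.) Simple stacked configuration: let $\mathcal{P}=\{p_1,\dots,p_n\}$ and $\mathcal{L}=\{l_1,\dots,l_m\}$. Put $\mathcal{P}'=\{p'_{i,j} : 1\le i\le n,\ j\in\{1,2\}\}$ ($2n$ distinct points), and $\mathcal{E}=\{e_1,\dots,e_m\}$, where $e_i=\{p'_{r,j} : p_r\in l_i,\ j\in\{1,2\}\}$. *)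

(* Defs.v *)
From mathcomp Require Import all_boot.

Set Implicit Arguments.
Unset Strict Implicit.
Unset Printing Implicit Defensive.

Section Incidence.

Variable T : finType.
Implicit Types (P : {set T}) (B : {set {set T}}).

Definition point_regular P B (s : nat) : Prop :=
  forall x, x \in P -> #|[set b in B | x \in b]| = s.

Definition block_regular B (t : nat) : Prop :=
  forall b, b \in B -> #|b| = t.

(* Type (n_s, m_t). *)
Definition of_type P B (n s m t : nat) : Prop :=
  [/\ #|P| = n, point_regular P B s, #|B| = m & block_regular B t].

Definition configuration1 P B : Prop :=
  [/\ P != set0,
      forall b, b \in B -> b \subset P,
      forall x y, x \in P -> y \in P -> x != y ->
        #|[set b in B | (x \in b) && (y \in b)]| <= 1
    & exists s t : nat,
        [/\ point_regular P B s, block_regular B t, 2 <= s & 2 <= t]].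

(* Possibly without dual: there is no lower bound on the number s of planes
   through a point. *)
Definition configuration2 P B : Prop :=
  [/\ forall b, b \in B -> b \subset P,
      forall x y z, x \in P -> y \in P -> z \in P ->
        x != y -> x != z -> y != z ->
        #|[set b in B | [&& x \in b, y \in b & z \in b]]| <= 1,
      exists s t : nat,
        [/\ point_regular P B s, block_regular B t & 3 <= t]
    & exists x y, [/\ x \in P, y \in P, x != y
        & 1 < #|[set b in B | (x \in b) && (y \in b)]|]].

(* The point p'_{i,j} is encoded as the pair (p_i, j), where the two elements
   of 'I_2 stand for the indices j = 1, 2. *)
Definition stack (A : {set T}) : {set T * 'I_2} :=
  [set q : T * 'I_2 | q.1 \in A].

Definition stacked_points P : {set T * 'I_2} := stack P.

Definition stacked_planes B : {set {set T * 'I_2}} :=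
  [set stack l | l in B].

End Incidence.

(* Main.v *)
Require Import Defs.
From mathcomp Require Import all_boot.

(** A point lies in [stack l] exactly when its projection to the first coordinate lies in [l], and
    [stack] is injective, so counting planes under an incidence condition amounts to counting lines
    ([card_stacked_planes]). Each fibre of the projection has only two points, so three distinct
    points project to at least two distinct points ([stacked_points_neq]), which share at most one
    line. Conversely, the two points of one fibre share all the planes coming from the lines through
    their projection, and there are at least two of these. *)

Lemma mem_stack {T : finType} (A : {set T}) (q : T * 'I_2) :
  (q \in stack A) = (q.1 \in A).
Proof. by rewrite inE. Qed.

Lemma stack_inj {T : finType} : injective (@stack T).
Proof.
move=> A B eqAB; apply/setP => x.
by rewrite -(mem_stack A (x, ord0)) eqAB mem_stack.
Qed.

Lemma card_stack {T : finType} (A : {set T}) : #|stack A| = 2 * #|A|.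
Proof.
have -> : stack A = setX A [set: 'I_2].
  by apply/setP => -[x j]; rewrite mem_stack !inE andbT.
by rewrite cardsX cardsT card_ord mulnC.
Qed.

(** Injectivity of [stack] makes the selected planes a bijective image of the selected lines. Taking
    [Q] to be incidence with one, two or three points reduces each count of planes to one of
    lines. *)
Lemma card_stacked_planes {T : finType} (L : {set {set T}})
    (Q : pred {set T * 'I_2}) :
  #|[set e in stacked_planes L | Q e]| = #|[set l in L | Q (stack l)]|.
Proof.
rewrite -[RHS](card_imset _ stack_inj); apply: eq_card => e.
rewrite inE; apply/andP/imsetP => [[/imsetP[l lL ->] Ql]|[l + ->]].
  by exists l; rewrite // inE lL.
by rewrite inE => /andP[lL Ql]; rewrite imset_f.
Qed.

Lemma stacked_point_regular {T : finType} (P : {set T}) (L : {set {set T}})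
    (s : nat) :
  point_regular P L s -> point_regular (stacked_points P) (stacked_planes L) s.
Proof.
move=> regP q; rewrite mem_stack => /regP <-.
rewrite (card_stacked_planes L (fun e => q \in e)).
by apply: eq_card => l; rewrite !inE.
Qed.

Lemma stacked_block_regular {T : finType} (L : {set {set T}}) (t : nat) :
  block_regular L t -> block_regular (stacked_planes L) (2 * t).
Proof. by move=> regL _ /imsetP[l /regL <- ->]; apply: card_stack. Qed.

(* Pigeonhole: only two layers are available. *)
Lemma stacked_points_neq {T : finType} {x y z : T * 'I_2} :
  x != y -> x != z -> y != z -> (x.1 != y.1) || (x.1 != z.1).
Proof.
case: x y z => [x i] [y j] [z k] /=; rewrite !xpair_eqE.
case: (eqVneq x y) => [<-|] //=; case: (eqVneq x z) => [_|] //=.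
rewrite -!val_eqE /=.
by case: i j k => [[|[|?]] ?] [[|[|?]] ?] [[|[|?]] ?].
Qed.

Theorem proposition7p1 (T : finType) (P : {set T}) (L : {set {set T}})
    (n s m t : nat) :
  configuration1 P L -> of_type P L n s m t ->
  configuration2 (stacked_points P) (stacked_planes L) /\
  of_type (stacked_points P) (stacked_planes L) (2 * n) s m (2 * t).
Proof.
move=> [P0 subP linP [s' [t' [regP' regL' s'2 t'2]]]] [cardP regP cardL regL].
split; last first.
  split; first by rewrite card_stack cardP.
  - exact: stacked_point_regular.
  - by rewrite card_imset //; apply: stack_inj.
  - exact: stacked_block_regular.
split.
- move=> _ /imsetP[l /subP/subsetP lP ->].
  by apply/subsetP => q; rewrite !mem_stack => /lP.
- move=> x y z; rewrite !mem_stack => xP yP zP xy xz yz.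
  rewrite (card_stacked_planes L (fun e => [&& x \in e, y \in e & z \in e])).
  (* Whichever of [y], [z] lies outside the fibre of [x] supplies the second point for [linP]; the
     condition on the remaining point is dropped. *)
  have /orP[xy1|xz1] := stacked_points_neq xy xz yz.
    apply: leq_trans (linP _ _ xP yP xy1); apply/subset_leq_card/subsetP => l.
    by rewrite !inE => /and4P[-> -> ->].
  apply: leq_trans (linP _ _ xP zP xz1); apply/subset_leq_card/subsetP => l.
  by rewrite !inE => /and4P[-> -> _ ->].
(* [s'] and [t'] are the parameters that carry the lower bounds: [t'2] gives [2 * t'] at least 4. *)
- exists s', (2 * t'); split.
  + exact: stacked_point_regular.
  + exact: stacked_block_regular.
  + by apply: (@leq_trans (2 * 2)); rewrite ?leq_mul2l.
- have /set0Pn[p pP] := P0.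
  (* These are the two points of the fibre over [p]; in ['I_2], [ord_max] is 1. A plane contains
     both exactly when its line contains [p], so there are [s'] such planes. *)
  exists (p, ord0), (p, ord_max); rewrite !mem_stack xpair_eqE eqxx.
  split=> //.
  rewrite (card_stacked_planes L
             (fun e => ((p, ord0) \in e) && ((p, ord_max) \in e))).
  apply: leq_trans s'2 _; rewrite -(regP' p pP).
  by apply/subset_leq_card/subsetP => l; rewrite !inE /= andbb.
Qed.
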